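(* Let $B_k\in\mathbb{R}^{(n+m)\times(n+m)}$ be $J$-symmetric and invertible, let $s_k,y_k\in\mathbb{R}^{n+m}$ with $s_k\ne0$, set $r=y_k-B_ks_k$, and let $$B_{k+1}=B_k+\frac{Js_k(y_k-B_ks_k)^TJ}{s_k^Ts_k}+\frac{(y_k-B_ks_k)s_k^T}{s_k^Ts_k}-\frac{(Js_k)^T(y_k-B_ks_k)\,Js_ks_k^T}{(s_k^Ts_k)^2}.$$ Let $P_k=I-\dfrac{s_ks_k^T}{s_k^Ts_k}$, $H_k=B_k^{-1}$ and $Q=B_k+\dfrac{(JP_kJr)s_k^T}{s_k^Ts_k}$. Suppose $Q$ and $B_{k+1}$ are invertible and let $H_{k+1}=B_{k+1}^{-1}$. Then $$H_{k+1}=Q^{-1}-\frac{Q^{-1}Js_k(Jr)^TQ^{-1}}{s_k^Ts_k+(Jr)^TQ^{-1}Js_k},\qquad\text{where}\qquad Q^{-1}=H_k-\frac{H_kJP_kJr\,s_k^TH_k}{s_k^Ts_k+s_k^TH_kJP_kJr}.$$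
   Context: $J=\begin{bmatrix} I_{n\times n}&0\\0&-I_{m\times m}\end{bmatrix}\in\mathbb{R}^{(n+m)\times(n+m)}$. A matrix $M\in\mathbb{R}^{(n+m)\times(n+m)}$ is called $J$-symmetric if $M=JM^TJ$. $I$ is the identity matrix of size $n+m$. *)

(* Defs.v *)
From HB Require Import structures.
From mathcomp Require Import all_boot all_order all_algebra.
Set Implicit Arguments.
Unset Strict Implicit.
Unset Printing Implicit Defensive.
Import Order.TTheory GRing.Theory Num.Theory.
Local Open Scope ring_scope.

Definition Jmx (R : realFieldType) (n m : nat) : 'M[R]_(n + m) :=
  block_mx 1%:M 0 0 (- 1%:M).

Definition Jsymmetric (R : realFieldType) (n m : nat) (M : 'M[R]_(n + m)) : Prop :=
  M = Jmx R n m *m M^T *m Jmx R n m.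

(* The 1 x 1 matrix u^T v read as a scalar. *)
Definition dot (R : realFieldType) (p : nat) (u v : 'cV[R]_p) : R :=
  (u^T *m v) 0 0.

(* Main.v *)
Require Import Defs.
From HB Require Import structures.
From mathcomp Require Import all_boot all_order all_algebra.
Set Implicit Arguments.
Unset Strict Implicit.
Unset Printing Implicit Defensive.
Import Order.TTheory GRing.Theory Num.Theory.
Local Open Scope ring_scope.

(** Both formulas are instances of the Sherman-Morrison identity for
    [A + c^-1 u v^T], in the form whose denominator is [c + v^T A^-1 u]
    ([sherman_morrison]).

    With [sigma = s^T s], the first rank-one correction turns [B] into [Q]: here
    [u = J P J r] and [v = s].  Since [J J = I], this vector is
    [J P J r = r - sigma^-1 ((J s)^T r) J s], so [Q] already contains the last two
    terms of the update.  What remains is [sigma^-1 J s (J r)^T], because [J] is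
    symmetric; hence the second correction, with [u = J s] and [v = J r], turns
    [Q] into the updated matrix.  The scalars [sigma + v^T A^-1 u] cannot vanish:
    that would put the vector [A^-1 u] in the kernel of the corrected matrix, which
    is invertible by hypothesis. *)

Lemma mulmx_dot (R : realFieldType) (p q : nat) (M : 'M[R]_(q, 1))
    (u v : 'cV[R]_p) : M *m (u^T *m v) = dot u v *: M.
Proof. by rewrite [u^T *m v]mx11_scalar mul_mx_scalar. Qed.

Lemma dot_self_neq0 (R : realFieldType) (p : nat) (u : 'cV[R]_p) :
  u != 0 -> dot u u != 0.
Proof.
apply: contra_neq => /eqP; rewrite /dot mxE psumr_eq0 => [/allP uu0|i _].
  apply/colP => i; have := uu0 i (mem_index_enum i).
  by rewrite !mxE -expr2 sqrf_eq0 => /eqP.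
by rewrite mxE -expr2 sqr_ge0.
Qed.

(** Writing [M] for the corrected matrix and [w = A^-1 u], everything follows
    from [M w = c^-1 d u], where [d = c + v^T w].  If [d = 0] then [M w = 0], so
    [w = 0] and [d = c], which is absurd.  Otherwise [d^-1 M w v^T A^-1] is exactly
    the excess [c^-1 u v^T A^-1] of [M A^-1] over the identity. *)
Lemma sherman_morrison (R : realFieldType) (p : nat) (A : 'M[R]_p)
    (u v : 'cV[R]_p) (c : R) :
  let M := A + c^-1 *: (u *m v^T) in
  let d := c + dot v (invmx A *m u) in
  c != 0 -> A \in unitmx -> M \in unitmx ->
  d != 0 /\
  invmx M = invmx A - d^-1 *: (invmx A *m u *m v^T *m invmx A).
Proof.
move=> M d c0 Au Mu.
have Mw : M *m (invmx A *m u) = (c^-1 * d) *: u.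
  rewrite mulmxDl mulKVmx // -scalemxAl -mulmxA mulmx_dot scalerA.
  by rewrite mulrDr mulVf // scalerDl scale1r.
have d0 : d != 0.
  apply: contra_neq c0 => d0.
  have w0 : invmx A *m u = 0.
    by rewrite -[LHS](mulKmx Mu) Mw d0 mulr0 scale0r mulmx0.
  by move: d0; rewrite /d w0 /dot mulmx0 mxE addr0.
split=> //; set N := RHS.
suff MN : M *m N = 1%:M by rewrite -[RHS](mulKmx Mu) MN mulmx1.
rewrite mulmxBr -scalemxAr -[_ *m v^T *m _]mulmxA [M *m (_ *m _)]mulmxA Mw.
rewrite -scalemxAl scalerA mulrCA mulVf // mulr1.
by rewrite mulmxDl mulmxV // -scalemxAl -mulmxA addrK.
Qed.

Lemma mul_Jmx_Jmx (R : realFieldType) (n m : nat) :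
  Jmx R n m *m Jmx R n m = 1%:M.
Proof.
rewrite /Jmx mulmx_block !mulmx0 !mul0mx !addr0 !add0r mulmx1.
by rewrite mulmxN mulNmx opprK mulmx1 -scalar_mx_block.
Qed.

Lemma tr_Jmx (R : realFieldType) (n m : nat) : (Jmx R n m)^T = Jmx R n m.
Proof. by rewrite /Jmx tr_block_mx !trmx0 linearN /= !trmx1. Qed.

Theorem proposition2p2 (R : realFieldType) (n m : nat)
    (B : 'M[R]_(n + m)) (s y : 'cV[R]_(n + m))
    (B_Jsym : Jsymmetric B) (B_unit : B \in unitmx) (s_neq0 : s != 0) :
  let J := Jmx R n m in
  let r := y - B *m s in
  let Bnext := B + (dot s s)^-1 *: (J *m s *m (y - B *m s)^T *m J)
                 + (dot s s)^-1 *: ((y - B *m s) *m s^T)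
                 - (dot (J *m s) (y - B *m s) / dot s s ^+ 2)
                     *: (J *m s *m s^T) in
  let P := 1%:M - (dot s s)^-1 *: (s *m s^T) in
  let H := invmx B in
  let Q := B + (dot s s)^-1 *: (J *m P *m J *m r *m s^T) in
  Q \in unitmx ->
  Bnext \in unitmx ->
  let Hnext := invmx Bnext in
  let Qinv := invmx Q in
  let alpha := dot s s + dot (J *m r) (Qinv *m J *m s) in
  let beta := dot s s + dot s (H *m J *m P *m J *m r) in
  [/\ alpha != 0,
      Hnext = Qinv - alpha^-1 *: (Qinv *m J *m s *m (J *m r)^T *m Qinv),
      beta != 0 &
      Qinv = H - beta^-1 *: (H *m J *m P *m J *m r *m s^T *m H)].
Proof.
move=> J r Bnext P H Q Qu Bu Hnext Qinv alpha beta.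
have c0 : dot s s != 0 := dot_self_neq0 s_neq0.
have JPJ x : J *m P *m J *m x = x - ((dot s s)^-1 * dot (J *m s) x) *: (J *m s).
  rewrite mulmxBr mulmx1 !mulmxBl mul_Jmx_Jmx mul1mx; congr (_ - _).
  rewrite -scalemxAr -!scalemxAl -scalerA -mulmx_dot trmx_mul tr_Jmx.
  by rewrite !mulmxA.
have BnextE : Bnext = Q + (dot s s)^-1 *: (J *m s *m (J *m r)^T).
  (* [r] stays opaque, lest its own subtraction be distributed as well. *)
  rewrite /Q JPJ /Bnext -/r; move: (r) => x.
  rewrite mulmxBl -scalemxAl scalerBr scalerA.
  rewrite trmx_mul tr_Jmx mulmxA mulrA -invfM -expr2 [_^-1 * dot _ _]mulrC.
  by rewrite -addrA addrAC.
have [beta0 QinvE] := sherman_morrison c0 B_unit Qu.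
rewrite /Hnext BnextE in Bu *.
have [alpha0 HnextE] := sherman_morrison c0 Qu Bu.
by move: beta0 QinvE alpha0 HnextE; rewrite /beta /alpha /Qinv /H !mulmxA.
Qed.
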